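(* Let $\lambda=(\lambda_1,\dots,\lambda_N)\in\mathbb{Z}_{\ge0}^N$, $|\lambda|=n$, and $I,J\in\mathcal I_\lambda$. As meromorphic functions of generic $u_1,\dots,u_n$ (with $z_k=q^{2u_k}$) and generic dynamical parameters: (1) $\widetilde W_J(z_I,z,\Pi)=0$ unless $I\leqslant J$. (2) $$\widetilde W_I(z_I,z,\Pi)=\prod_{1\le k<l\le N}\ \prod_{a\in I_k}\ \prod_{\substack{b\in I_l\\ a<b}}\frac{[u_b-u_a]}{[u_b-u_a+1]}.$$
   Context: **Theta function.** $0<|q|<1$ (branch of $\log q$ fixed), $r$ a generic positive real, $p=q^{2r}$, $[u]=q^{u^2/r-u}\Theta_p(q^{2u})$, $\Theta_p(z)=(z;p)_\infty(p/z;p)_\infty(p;p)_\infty$, $(x;p)_\infty=\prod_{n\ge0}(1-xp^n)$. **Combinatorics.** $\mathcal I_\lambda$ is the set of partitions $I=(I_1,\dots,I_N)$ of $\{1,\dots,n\}$ into disjoint subsets with $|I_l|=\lambda_l$; equivalently $I=I_{\mu_1\cdots\mu_n}$, $\mu_i=l\Leftrightarrow i\in I_l$. $\lambda^{(l)}=\lambda_1+\cdots+\lambda_l$, $I^{(l)}=I_1\cup\cdots\cup I_l=\{i^{(l)}_1<\cdots<i^{(l)}_{\lambda^{(l)}}\}$. Partial order: $I\leqslant J$ iff $i^{(l)}_a\le j^{(l)}_a$ for all $l,a$ (where $J^{(l)}=\{j^{(l)}_1<\cdots<j^{(l)}_{\lambda^{(l)}}\}$). **Variables.** $t=(t^{(l)}_a)_{1\le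 l\le N-1,\,1\le a\le\lambda^{(l)}}$, $t^{(l)}_a=q^{2v^{(l)}_a}$, $z_k=q^{2u_k}$, $v^{(N)}_k=u_k$. Generic dynamical parameters $(P+h)_{j,k}$ with $(P+h)_{j,k}+(P+h)_{k,l}=(P+h)_{j,l}$; $\Pi_{j,k}=q^{2(P+h)_{j,k}}$. $C_{\mu_s,l+1}(s)=\sum_{j=s+1}^n(\delta_{\mu_j,\mu_s}-\delta_{\mu_j,l+1})$. **Weight functions.** $W_I(t,z,\Pi)=\mathrm{Sym}_{t^{(1)}}\cdots\mathrm{Sym}_{t^{(N-1)}}U_I(t,z,\Pi)$, where $\mathrm{Sym}_{t^{(l)}}$ is the sum over all permutations of $t^{(l)}_1,\dots,t^{(l)}_{\lambda^{(l)}}$ and \begin{align*}U_I=\prod_{l=1}^{N-1}\prod_{a=1}^{\lambda^{(l)}}\Bigg(&\frac{[v^{(l+1)}_b-v^{(l)}_a+(P+h)_{\mu_s,l+1}-C_{\mu_s,l+1}(s)][1]}{[(P+h)_{\mu_s,l+1}-C_{\mu_s,l+1}(s)]}\Bigg|_{i^{(N)}_s=i^{(l+1)}_b=i^{(l)}_a}\\&\times\prod_{\substack{b=1\\ i^{(l+1)}_b>i^{(l)}_a}}^{\lambda^{(l+1)}}[v^{(l+1)}_b-v^{(l)}_a]\prod_{\substack{b=1\\ i^{(l+1)}_b<i^{(l)}_a}}^{\lambda^{(l+1)}}[v^{(l+1)}_b-v^{(l)}_a+1]\prod_{b=a+1}^{\lambda^{(l)}}\frac{[v^{(l)}_b-v^{(l)}_a+1]}{[v^{(l)}_b-v^{(l)}_a]}\Bigg)\end{align*}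 (in the first factor $b,s$ are the indices determined by $i^{(N)}_s=s=i^{(l+1)}_b=i^{(l)}_a$). $H_\lambda(t,z)=\prod_{l=1}^{N-1}\prod_{a=1}^{\lambda^{(l)}}\prod_{b=1}^{\lambda^{(l+1)}}[v^{(l+1)}_b-v^{(l)}_a+1]$ and $\widetilde W_I=W_I/H_\lambda$. **Specialization.** $\widetilde W_J(z_I,z,\Pi)$ denotes the value of $\widetilde W_J(t,z,\Pi)$ at $v^{(l)}_a=u_{i^{(l)}_a}$ (i.e. $t^{(l)}_a=z_{i^{(l)}_a}$) for $l=1,\dots,N-1$, $a=1,\dots,\lambda^{(l)}$. *)

(* Defs.v *)
From mathcomp Require Import all_boot all_order all_algebra all_fingroup.
From mathcomp Require Import complex.
From mathcomp Require Import all_classical all_reals all_analysis.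

Set Implicit Arguments.
Unset Strict Implicit.
Unset Printing Implicit Defensive.

Import Order.TTheory GRing.Theory Num.Theory numFieldNormedType.Exports.
Local Open Scope ring_scope.
Local Open Scope complex_scope.

(* (x; p)_oo.  Stated over an arbitrary numFieldType so that the limit is taken
   for the topology induced by the norm; it is used below at R[i]. *)
Definition qpochhammer (K : numFieldType) (x p : K) : K :=
  limn (fun m : nat => \prod_(k < m) (1 - x * p ^+ k)).

Definition Theta (K : numFieldType) (p z : K) : K :=
  qpochhammer z p * qpochhammer (p / z) p * qpochhammer p p.

Section Bracket.
Variable R : realType.

Definition cexp (z : R[i]) : R[i] :=
  (expR (complex.Re z))%:C *
  (cos (complex.Im z) +i* sin (complex.Im z)).

(* q ^ x for the branch of the logarithm of q given by logq. *)
Definition qpow (logq x : R[i]) : R[i] := cexp (x * logq).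

(* [u] = q ^ (u^2/r - u) Theta_p (q ^ (2u)), with p = q ^ (2r). *)
Definition bracket (logq : R[i]) (r : R) (u : R[i]) : R[i] :=
  qpow logq (u ^+ 2 / r%:C - u) *
  Theta (qpow logq (2 * r%:C)) (qpow logq (2 * u)).

End Bracket.

(* Indexing.  Elements of {1..n} and colours {1..N} are 0-based ordinals:
   k : 'I_n stands for k + 1 and c : 'I_N stands for the colour c + 1.  Levels
   (superscripts) are natural numbers and keep their usual values 1, .., N.
   Hence, for an ordinal l : 'I_N with 0 < l, used as a level, the same l used
   as a colour is the colour "l + 1" of the usual numbering. *)
Section Combinatorics.
Variables N n : nat.

(* A partition (I_1, .., I_N) of {1..n} is given by mu_1 .. mu_n, where
   mu_i = l iff i belongs to I_l. *)
Definition block (I : {ffun 'I_n -> 'I_N}) (c : 'I_N) : {set 'I_n} :=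
  [set i | I i == c].

Definition is_partition (lam : 'I_N -> nat) (I : {ffun 'I_n -> 'I_N}) : Prop :=
  forall c : 'I_N, #|block I c| = lam c.

Definition lamup (lam : 'I_N -> nat) (l : nat) : nat :=
  (\sum_(c < N | (c < l)%N) lam c)%N.

Definition Iup (I : {ffun 'I_n -> 'I_N}) (l : nat) : {set 'I_n} :=
  (\bigcup_(c < N | (c < l)%N) block I c)%SET.

(* i^{(l)}_a: enum lists the elements of a set of ordinals in increasing order.
   Only a < lamup lam l is meaningful; the default value a is a dummy. *)
Definition elt (I : {ffun 'I_n -> 'I_N}) (l : nat) (a : 'I_n) : 'I_n :=
  nth a (enum (Iup I l)) a.

Definition part_le (lam : 'I_N -> nat) (I J : {ffun 'I_n -> 'I_N}) : Prop :=
  forall (l : nat) (a : 'I_n), (0 < l <= N)%N -> (a < lamup lam l)%N ->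
    (elt I l a <= elt J l a)%N.

Definition Cshift (I : {ffun 'I_n -> 'I_N}) (c : 'I_N) (s : 'I_n) : int :=
  \sum_(j < n | (s < j)%N) ((I j == I s)%:R - (I j == c)%:R).

End Combinatorics.

Section WeightFunctions.
Variables (R : realType) (logq : R[i]) (r : R) (N n : nat) (lam : 'I_N -> nat).

Local Notation "[[ x ]]" := (bracket logq r x) (at level 0, x at level 200).

(* The variables v^{(l)}_a, 1 <= l <= N-1, 1 <= a <= lambda^{(l)}, are the values
   v l a with 0 < l < N and a < lamup lam l; other values of v are never used. *)
Definition vars := nat -> 'I_n -> R[i].

(* v^{(l)}, with the convention v^{(N)} = u. *)
Definition lev (v : vars) (u : 'I_n -> R[i]) (l : nat) : 'I_n -> R[i] :=
  if l == N then u else v l.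

(* P j k stands for (P+h)_{j,k}.  The product over the b with
   i^{(l+1)}_b = i^{(l)}_a has exactly one factor. *)
Definition Ufun (I : {ffun 'I_n -> 'I_N}) (u : 'I_n -> R[i])
    (P : 'I_N -> 'I_N -> R[i]) (v : vars) : R[i] :=
  \prod_(l < N | (0 < l)%N) \prod_(a < n | (a < lamup lam l)%N)
   ((\prod_(b < n | (b < lamup lam l.+1)%N && (elt I l.+1 b == elt I l a))
       let s := elt I l a in
       let d := P (I s) l - (Cshift I l s)%:~R in
       [[lev v u l.+1 b - lev v u l a + d]] * [[1]] / [[d]])
    * (\prod_(b < n | (b < lamup lam l.+1)%N && (elt I l a < elt I l.+1 b)%N)
         [[lev v u l.+1 b - lev v u l a]])
    * (\prod_(b < n | (b < lamup lam l.+1)%N && (elt I l.+1 b < elt I l a)%N)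
         [[lev v u l.+1 b - lev v u l a + 1]])
    * (\prod_(b < n | (a < b < lamup lam l)%N)
         ([[lev v u l b - lev v u l a + 1]] / [[lev v u l b - lev v u l a]]))).

(* Permutations of v^{(l)}_1, .., v^{(l)}_{lambda^{(l)}} are represented as the
   permutations of 'I_n supported on the first lambda^{(l)} indices. *)
Definition Sym (l : nat) (F : vars -> R[i]) (v : vars) : R[i] :=
  \sum_(s : 'S_n | perm_on [set a : 'I_n | (a < lamup lam l)%N]%SET s)
    F (fun k a => if k == l then v k (s a) else v k a).

(* Sym_{t^{(1)}} (.. (Sym_{t^{(N-1)}} U_I)). *)
Definition Wfun (I : {ffun 'I_n -> 'I_N}) (u : 'I_n -> R[i])
    (P : 'I_N -> 'I_N -> R[i]) : vars -> R[i] :=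
  foldr Sym (Ufun I u P) (iota 1 N.-1).

Definition Hfun (u : 'I_n -> R[i]) (v : vars) : R[i] :=
  \prod_(l < N | (0 < l)%N) \prod_(a < n | (a < lamup lam l)%N)
    \prod_(b < n | (b < lamup lam l.+1)%N)
      [[lev v u l.+1 b - lev v u l a + 1]].

Definition Wtilde (I : {ffun 'I_n -> 'I_N}) (u : 'I_n -> R[i])
    (P : 'I_N -> 'I_N -> R[i]) (v : vars) : R[i] :=
  Wfun I u P v / Hfun u v.

(* The point v^{(l)}_a = u_{i^{(l)}_a}, i.e. t = z_I. *)
Definition spec (I : {ffun 'I_n -> 'I_N}) (u : 'I_n -> R[i]) : vars :=
  fun l a => u (elt I l a).

(* Genericity: no denominator occurring in Wtilde at the points spec I u, or in
   the evaluation formula, vanishes.  The condition [1] <> 0 is a condition on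
   r alone (1/r is not an integer). The shifts Cshift are less than n in
   absolute value, so the exceptional set is a locally finite union of
   hyperplanes. *)
Definition generic (u : 'I_n -> R[i]) (P : 'I_N -> 'I_N -> R[i]) : Prop :=
  [/\ [[1]] != 0,
      forall a b : 'I_n, a != b ->
        [[u b - u a]] != 0 /\ [[u b - u a + 1]] != 0
    & forall (j k : 'I_N) (m : int), (j < k)%N -> (`|m| < n)%N ->
        [[P j k + m%:~R]] != 0].

End WeightFunctions.

(* Main.v *)
Require Import Defs.
From mathcomp Require Import all_boot all_order all_algebra all_fingroup.
From mathcomp Require Import complex ring.
From mathcomp Require Import all_classical all_reals all_analysis.
Import Order.TTheory GRing.Theory Num.Theory numFieldNormedType.Exports.
Local Open Scope ring_scope.
Local Open Scope complex_scope.
Set Implicit Arguments.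
Unset Strict Implicit.
Unset Printing Implicit Defensive.

(** Write [x] for the bracket.  The only zero that matters is [0] = 0, so
    the theorem is about when two variables in a factor of U_J coincide.

    W_J is a sum of values of U_J at the points obtained by permuting, for each
    level l < N, the variables of that level.  At t = z_I such a point is given
    by permutations s_l (with s_N = 1), and its variable (l, a) has the value
    u_y with y = i^(l)_{s_l(a)}.  Since I^(l) is contained in I^(l+1), the same
    value u_y also occurs at level l+1, at some index b.  If j^(l)_a were
    smaller than j^(l+1)_b, the factor [v^(l+1)_b - v^(l)_a] of U_J would be
    [0].  So in a nonzero term j^(l+1)_b <= j^(l)_a, and following u_y from
    level l up to level N, where both enumerations are the identity, gives
    y <= j^(l)_a: this is [Ufun_neq0_dominated].

    Hence a nonzero term yields i^(l)_{s_l(a)} <= j^(l)_a for all l and a.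
    Sorting removes the permutation ([perm_dominated_le]) and leaves I <= J,
    which is the vanishing statement.  If I = J it says s_l(a) <= a, so that
    every s_l is the identity ([perm_decreasing_id]) and W_I reduces to the
    single value U_I(z_I).

    That value is computed one pair (l, s) with s in I^(l) at a time.  The
    dynamical factor collapses to [1], because its two variables coincide.  What
    is left, divided by the corresponding part of H, telescopes between I^(l)
    and I^(l+1), the disjoint union of I^(l) and I_{l+1}: only the x in I_{l+1}
    with x > s survive, each with the factor [u_x - u_s] / [u_x - u_s + 1]
    ([prod_level_ratio]).  Collecting the s in I^(l) by colour gives the product formula. *)

(** * Zero of the bracket *)

Lemma qpochhammer1 (K : numFieldType) (p : K) : qpochhammer 1 p = 0.
Proof.
apply: cvg_lim; first exact: norm_hausdorff.
apply: cvg_near_cst; exists 1%N => // -[//|m] _.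
by rewrite big_ord_recl expr0 mulr1 subrr mul0r.
Qed.

Lemma bracket0 (R : realType) (logq : R[i]) (r : R) : bracket logq r 0 = 0.
Proof.
rewrite /bracket /Theta /qpow !mulr0 mul0r.
have -> : cexp 0 = 1 :> R[i].
  by rewrite /cexp /= expR0 cos0 sin0 mul1r.
by rewrite qpochhammer1 !mul0r mulr0.
Qed.

(** * Permutations dominated by an order *)

(** Sorted sequences can be compared after an arbitrary rearrangement of one of
    them.  By the pigeonhole principle some b <= a has s b >= a, and then
    f a <= f (s b) <= g b <= g a. *)
Lemma perm_dominated_le n m (s : 'S_n) (f g : 'I_n -> nat) :
  perm_on [set a : 'I_n | (a < m)%N]%SET s ->
  (forall a b : 'I_n, (a <= b)%N -> (b < m)%N -> (f a <= f b)%N) ->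
  (forall a b : 'I_n, (a <= b)%N -> (b < m)%N -> (g a <= g b)%N) ->
  (forall a : 'I_n, (a < m)%N -> (f (s a) <= g a)%N) ->
  forall a : 'I_n, (a < m)%N -> (f a <= g a)%N.
Proof.
move=> sm fmono gmono fg a am.
have [b /andP[ba asb]|noB] :=
    pickP (fun b : 'I_n => (b <= a)%N && (a <= s b)%N).
  have bm : (b < m)%N := leq_ltn_trans ba am.
  have sbm : (s b < m)%N by have := perm_closed b sm; rewrite !inE bm.
  exact: leq_trans (fmono _ _ asb sbm) (leq_trans (fg _ bm) (gmono _ _ ba am)).
(* Otherwise s would inject the a + 1 indices b <= a into the indices < a. *)
set A := [set b : 'I_n | (b <= a)%N]%SET.
have /subset_leq_card : (s @: A)%SET \subset (A :\ a)%SET.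
  apply/fintype.subsetP => y /imsetP[b]; rewrite !inE => ba -> {y}.
  have := noB b; rewrite ba /= => /negbT; rewrite -ltnNge => sba.
  by rewrite (ltnW sba) andbT; apply: contraTneq sba => ->; rewrite ltnn.
rewrite card_imset; last exact: perm_inj.
by rewrite [X in (X <= _)%N](cardsD1 a) inE leqnn add1n ltnn.
Qed.

Lemma perm_decreasing_id n (s : 'S_n) : (forall a, (s a <= a)%N) -> s = 1%g.
Proof.
move=> sle; apply/permP => a; rewrite perm1; move: {2}(val a) (leqnn a) => k.
elim: k a => [|k IH] a ak; apply/val_inj/eqP => /=.
  by have := sle a; move: ak; rewrite !leqn0 => /eqP->; rewrite leqn0.
rewrite eqn_leq sle /= leqNgt; apply/negP => lt.
have /perm_inj E : s (s a) = s a by apply: IH; rewrite -ltnS (leq_trans lt).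
by rewrite E ltnn in lt.
Qed.

(** * Enumeration of the sets of a partition *)

Lemma sorted_enum_set n (A : {set 'I_n}) : sorted ltn (map val (enum A)).
Proof.
apply: (subseq_sorted ltn_trans) (iota_ltn_sorted 0 n).
rewrite -val_enum_ord; apply: map_subseq; rewrite {1}/enum_mem -enumT.
exact: filter_subseq.
Qed.

Section Partitions.
Variables (N n : nat) (lam : 'I_N -> nat) (I : {ffun 'I_n -> 'I_N}).
Hypothesis hI : is_partition lam I.

Lemma mem_Iup l i : (i \in Iup I l) = (I i < l)%N.
Proof.
apply/bigcupP/idP => [[c cl]|Il]; first by rewrite inE => /eqP->.
by exists (I i); rewrite ?inE.
Qed.

Lemma Iup_full : Iup I N = [set: 'I_n]%SET.
Proof. by apply/setP => i; rewrite mem_Iup !inE ltn_ord. Qed.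

(** The level l, read as a 0-based colour, is exactly the colour that is added
    in passing from level l to level l + 1. *)
Lemma IupS (l : 'I_N) : Iup I l.+1 = (Iup I l :|: block I l)%SET.
Proof.
by apply/setP => i; rewrite !inE !mem_Iup ltnS leq_eqVlt orbC.
Qed.

Lemma card_Iup l : #|Iup I l| = lamup lam l.
Proof.
rewrite -sum1_card (partition_big I (fun c : 'I_N => (c < l)%N)) /=; last first.
  by move=> i; rewrite mem_Iup.
apply: eq_bigr => c cl; rewrite -(hI c) -sum1_card; apply: eq_bigl => i.
by rewrite mem_Iup inE; apply: andb_idl => /eqP->.
Qed.

Lemma size_enum_Iup l : size (enum (Iup I l)) = lamup lam l.
Proof. by rewrite -cardE card_Iup. Qed.

Lemma mem_elt l (a : 'I_n) : (a < lamup lam l)%N -> elt I l a \in Iup I l.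
Proof. by move=> al; rewrite -mem_enum mem_nth // size_enum_Iup. Qed.

Lemma elt_ltn l (a b : 'I_n) :
  (a < b)%N -> (b < lamup lam l)%N -> (elt I l a < elt I l b)%N.
Proof.
move=> ab bl; have al := ltn_trans ab bl.
have E (c : 'I_n) : (c < lamup lam l)%N ->
    elt I l c = nth 0%N (map val (enum (Iup I l))) c :> nat.
  by move=> cl; rewrite (nth_map c) ?size_enum_Iup.
rewrite !E //; apply: (sorted_ltn_nth ltn_trans) ab;
  by rewrite ?sorted_enum_set // inE size_map size_enum_Iup.
Qed.

Lemma elt_leq l (a b : 'I_n) :
  (a <= b)%N -> (b < lamup lam l)%N -> (elt I l a <= elt I l b)%N.
Proof.
rewrite leq_eqVlt => /predU1P[/val_inj->//|ab] bl.
exact/ltnW/elt_ltn.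
Qed.

Lemma elt_ltnE l (a b : 'I_n) : (a < lamup lam l)%N -> (b < lamup lam l)%N ->
  (elt I l a < elt I l b)%N = (a < b)%N.
Proof.
move=> al bl; apply/idP/idP => [|ab]; last exact: elt_ltn.
by apply: contraLR; rewrite -!leqNgt => ba; apply: elt_leq.
Qed.

Lemma elt_full (a : 'I_n) : elt I N a = a.
Proof. by rewrite /elt Iup_full enum_setT -enumT nth_ord_enum. Qed.

(** Left inverse of the enumeration [elt I l], used to reindex products over
    positions as products over elements; the default y is never reached on
    [Iup I l]. *)
Definition rank l (y : 'I_n) : 'I_n := insubd y (index y (enum (Iup I l))).

Lemma rankE l y : y \in Iup I l -> rank l y = index y (enum (Iup I l)) :> nat.
Proof.
move=> yl; rewrite val_insubd ifT //.
have yl' : y \in enum (Iup I l) by rewrite mem_enum.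
move: yl'; rewrite -index_mem -cardE => /leq_trans; apply.
by rewrite (leq_trans (max_card _)) ?card_ord.
Qed.

Lemma rank_lt l y : y \in Iup I l -> (rank l y < lamup lam l)%N.
Proof.
by move=> yl; rewrite rankE // -size_enum_Iup index_mem mem_enum.
Qed.

Lemma rankK l y : y \in Iup I l -> elt I l (rank l y) = y.
Proof. by move=> yl; rewrite /elt rankE // nth_index // mem_enum. Qed.

Lemma eltK l (a : 'I_n) : (a < lamup lam l)%N -> rank l (elt I l a) = a.
Proof.
move=> al; apply/val_inj => /=; rewrite rankE ?mem_elt //.
by rewrite index_uniq ?enum_uniq ?size_enum_Iup.
Qed.

Lemma big_elt (V : Type) (idx : V) (op : Monoid.com_law idx) l
    (Q : pred 'I_n) (F : 'I_n -> V) :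
  \big[op/idx]_(a < n | (a < lamup lam l)%N && Q (elt I l a)) F (elt I l a) =
  \big[op/idx]_(x in Iup I l | Q x) F x.
Proof.
rewrite [RHS](reindex_onto (elt I l) (rank l)) /=; last first.
  by move=> x /andP[xl _]; apply: rankK.
apply: eq_bigl => a.
have [al|al] := boolP (a < lamup lam l)%N.
  by rewrite eltK // eqxx mem_elt // !andbT.
(* Ranks of elements are in range, so an a out of range contributes nothing. *)
apply/esym/negP => /andP[/andP[/rank_lt lt _] /eqP E].
by rewrite E (negPf al) in lt.
Qed.

Lemma big_elt_all (V : Type) (idx : V) (op : Monoid.com_law idx) l
    (F : 'I_n -> V) :
  \big[op/idx]_(a < n | (a < lamup lam l)%N) F (elt I l a) =
  \big[op/idx]_(x in Iup I l) F x.
Proof.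
rewrite -[RHS](eq_bigl _ _ (fun x => andbT (x \in Iup I l))) -(big_elt op l predT).
by apply: eq_bigl => a; rewrite andbT.
Qed.

(** The telescoping behind the evaluation, with g x = [u_x - u_s] and
    h x = [u_x - u_s + 1].  The denominator splits into x < s, x = s and x > s;
    the first two parts cancel, leaving the product of g / h over the x > s of
    level l + 1 divided by the same product over level l. *)
Lemma prod_level_ratio (F : fieldType) (l : 'I_N) s (g h : 'I_n -> F) :
  s \in Iup I l -> (forall x : 'I_n, x != s -> g x != 0) ->
  (forall x, h x != 0) ->
  (h s * (\prod_(x in Iup I l.+1 | (s < x)%N) g x)
       * (\prod_(x in Iup I l.+1 | (x < s)%N) h x)
       * (\prod_(x in Iup I l | (s < x)%N) (g x / h x)^-1))
  / \prod_(x in Iup I l.+1) h x =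
  \prod_(x in block I l | (s < x)%N) (g x / h x).
Proof.
move=> sl g0 h0.
have sS : s \in Iup I l.+1 by move: sl; rewrite !mem_Iup => /leqW.
have Eh : \prod_(x in Iup I l.+1) h x =
    (\prod_(x in Iup I l.+1 | (s < x)%N) h x) *
    (h s * \prod_(x in Iup I l.+1 | (x < s)%N) h x).
  rewrite (bigID (fun x : 'I_n => (s < x)%N)) /=; congr (_ * _).
  rewrite (bigD1 s) /=; last by rewrite sS ltnn.
  congr (_ * _); apply: eq_bigl => x.
  rewrite -andbA; congr (_ && _); rewrite -leqNgt [in RHS]ltn_neqAle andbC.
  by rewrite -val_eqE.
have E : \prod_(x in Iup I l.+1 | (s < x)%N) (g x / h x) =
    (\prod_(x in Iup I l | (s < x)%N) (g x / h x)) *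
    \prod_(x in block I l | (s < x)%N) (g x / h x).
  rewrite (bigID (mem (Iup I l))) /=; congr (_ * _); apply: eq_bigl => x.
    by rewrite IupS finset.in_setU; case: (x \in Iup I l); rewrite ?andbT ?andbF.
  rewrite IupS finset.in_setU mem_Iup inE -val_eqE /=.
  by case: ltngtP => _; rewrite /= ?andbF ?andbT.
have n0 (Q : pred 'I_n) : \prod_(x in Iup I l.+1 | Q x) h x != 0.
  by apply/prodf_neq0 => x _; apply: h0.
have C0 : \prod_(x in Iup I l | (s < x)%N) (g x / h x) != 0.
  apply/prodf_neq0 => x /andP[_ sx]; rewrite mulf_neq0 ?invr_neq0 ?g0 ?h0 //.
  by apply: contraTneq sx => ->; rewrite ltnn.
rewrite -[RHS](mulKf C0) -E prodfV Eh.
move: (\prod_(x in Iup I l | (s < x)%N) (g x / h x)) C0 => C C0; rewrite prodf_div.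
by field; rewrite C0 h0 !n0.
Qed.

(** Each of the n - 1 - s terms of the shift is -1, 0 or 1, so the shift stays in
    the range where the dynamical brackets are known not to vanish. *)
Lemma abs_Cshift_lt c s : (`|Cshift I c s| < n)%N.
Proof.
rewrite -ltz_nat abszE /Cshift (le_lt_trans (ler_norm_sum _ _ _)) //.
apply: (@le_lt_trans _ _ (\sum_(j < n | (s < j)%N) 1)).
  by apply: ler_sum => j _; do 2 case: eqP.
rewrite sumr_const -mulr_natr mul1r natz ltz_nat.
rewrite -[X in (_ < X)%N]card_ord; apply: proper_card; apply/properP; split.
  by apply/fintype.subsetP.
by exists s; rewrite // unfold_in; apply/negbT/ltnn.
Qed.

End Partitions.

(** * Iterated symmetrization *)

Section SymmetrizedSums.
Variables (R : realType) (N n : nat) (lam : 'I_N -> nat).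
Implicit Types (F : vars R n -> R[i]) (v : vars R n) (sg : nat -> 'S_n).

(** Families of permutations, one per level, indexing the terms of the sum
    obtained by expanding the symmetrizations over the levels in ls. *)
Definition admissible (ls : seq nat) sg : Prop := forall l,
  if l \in ls then
    is_true (perm_on [set a : 'I_n | (a < lamup lam l)%N]%SET (sg l))
  else sg l = 1%g.

Definition permute sg v : vars R n := fun l a => v l (sg l a).

(** One more symmetrization adds its permutation to the family. *)
Lemma permuteM sg l (s : 'S_n) v : sg l = 1%g ->
  permute sg (fun k a => if k == l then v k (s a) else v k a) =
  permute (fun k => if k == l then s else sg k) v.
Proof.
move=> sgl; apply/funext => k; apply/funext => a; rewrite /permute.
by case: eqP => [->|//]; rewrite sgl perm1.
Qed.

Lemma admissible_cons l ls sg (s : 'S_n) : l \notin ls -> admissible ls sg ->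
  perm_on [set a : 'I_n | (a < lamup lam l)%N]%SET s ->
  admissible (l :: ls) (fun k => if k == l then s else sg k).
Proof. by move=> lls ad sl k; rewrite inE; case: eqP => [->//|_]; apply: ad. Qed.

Lemma admissible_out ls sg l : admissible ls sg -> l \notin ls -> sg l = 1%g.
Proof. by move=> ad /negPf lls; have := ad l; rewrite lls. Qed.

Lemma foldr_Sym_eq0 F ls v : uniq ls ->
  (forall sg, admissible ls sg -> F (permute sg v) = 0) ->
  foldr (Defs.Sym lam) F ls v = 0.
Proof.
elim: ls v => [|l ls IH] v /= => [_ F0|/andP[lls uls] F0].
  rewrite -[v](_ : permute (fun=> 1%g) v = v) ?F0 //.
  by apply/funext => k; apply/funext => a; rewrite /permute perm1.
rewrite {1}/Defs.Sym big1 // => s sl; apply: IH => // sg ad.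
rewrite permuteM; last exact: admissible_out ad lls.
exact/F0/admissible_cons.
Qed.

(** If only the identity family contributes, the iterated sum is its value. For
    a nonidentity permutation at the outermost level, every term of the inner
    sum belongs to a nonidentity family, so the inner sum vanishes. *)
Lemma foldr_Sym_id F ls v : uniq ls ->
  (forall sg, admissible ls sg -> F (permute sg v) != 0 ->
     forall l, l \in ls -> sg l = 1%g) ->
  foldr (Defs.Sym lam) F ls v = F v.
Proof.
elim: ls v => [//|l ls IH] v /= /andP[lls uls] F0.
rewrite {1}/Defs.Sym (bigD1 (1%g : 'S_n)) ?perm_on1 //= big1 => [|s /andP[sl sn1]].
  rewrite addr0 (_ : (fun k a => _) = v); last first.
    by apply/funext => k; apply/funext => a; rewrite perm1 if_same.
  apply: IH => // sg ad Fn0 k kls; apply: F0 => //; last by rewrite inE kls orbT.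
  move=> j; rewrite inE; have := ad j; case: eqP => [->|//].
  by rewrite (negPf lls) /= => ->; apply: perm_on1.
apply: foldr_Sym_eq0 => // sg ad.
rewrite permuteM; last exact: admissible_out ad lls.
apply/eqP/negPn/negP => Fn0; case/eqP: sn1.
have := F0 _ (admissible_cons lls ad sl) Fn0 l.
by rewrite eqxx mem_head; apply.
Qed.

End SymmetrizedSums.

(** * Specialized weight functions *)

Section WeightFunctions.
Variables (R : realType) (logq : R[i]) (r : R) (N n : nat) (lam : 'I_N -> nat).
Variables (u : 'I_n -> R[i]) (P : 'I_N -> 'I_N -> R[i]).
Local Notation br := (bracket logq r).
Implicit Types I J : {ffun 'I_n -> 'I_N}.

(** At level N the variables are u_1, .., u_n themselves and the enumeration of
    I^(N) is the identity, so the same formula is valid at all levels. *)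
Lemma lev_permute_spec I (sg : nat -> 'S_n) (l : nat) a :
  sg N = 1%g -> lev N (permute sg (spec I u)) u l a = u (elt I l (sg l a)).
Proof.
move=> sgN; rewrite /lev; case: eqP => // ->.
by rewrite sgN perm1 elt_full.
Qed.

Lemma lev_spec I (l : nat) a : lev N (spec I u) u l a = u (elt I l a).
Proof. by rewrite /lev; case: eqP => // ->; rewrite elt_full. Qed.

Lemma levels_notin : N \notin iota 1 N.-1.
Proof. by case: (N) => //= m; rewrite mem_iota add1n ltnn andbF. Qed.

Lemma mem_levels l : (l \in iota 1 N.-1) = (0 < l < N)%N.
Proof. by case: (N) => [|m]; [rewrite ltn0 andbF|rewrite mem_iota]. Qed.

(** Downward induction on l from l = N, where both sides are a.  The value
    attached to a at level l reappears at level l + 1 at an index b, and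
    elt J l a < elt J l.+1 b would put the factor [0] in U_J. *)
Lemma Ufun_neq0_dominated I J sg :
  is_partition lam I -> is_partition lam J ->
  admissible lam (iota 1 N.-1) sg ->
  Ufun logq r lam J u P (permute sg (spec I u)) != 0 ->
  forall l (a : 'I_n), (0 < l <= N)%N -> (a < lamup lam l)%N ->
    (elt I l (sg l a) <= elt J l a)%N.
Proof.
move=> hI hJ ad Un0.
have sgN : sg N = 1%g by apply: admissible_out ad levels_notin.
have sg_lt l (a : 'I_n) : (a < lamup lam l)%N -> (sg l a < lamup lam l)%N.
  have := ad l; case: ifP => [_ sl|_ ->]; last by rewrite perm1.
  by have := perm_closed a sl; rewrite !inE => ->.
(* Induction on k = N - l. *)
suff H k (a l : nat) (al : (a < n)%N) : (l + k)%N = N -> (0 < l)%N ->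
    (a < lamup lam l)%N ->
    (elt I l (sg l (Ordinal al)) <= elt J l (Ordinal al))%N.
  move=> l [a an] /andP[l0 lN] al.
  exact: (H (N - l)%N _ _ an (subnKC lN)).
elim: k a l al => [|k IH] a l an; set oa := Ordinal an.
  by rewrite addn0 => -> _ _; rewrite !elt_full sgN perm1.
move=> lkN l0 al.
have lN : (l < N)%N by rewrite -lkN addnS ltnS leq_addr.
set y := elt I l (sg l oa).
have yS : y \in Iup I l.+1.
  by have := mem_elt hI (sg_lt l oa al); rewrite !mem_Iup => /leqW.
have [b bS yE] : exists2 b : 'I_n, (b < lamup lam l.+1)%N
    & elt I l.+1 (sg l.+1 b) = y.
  exists ((sg l.+1)^-1%g (rank I l.+1 y)); last by rewrite permKV rankK.
  have := sg_lt l.+1 ((sg l.+1)^-1%g (rank I l.+1 y)); rewrite permKV.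
  have := rank_lt hI yS; have := ad l.+1; case: ifP => [_ sl|_ -> lt]; last first.
    by rewrite invg1 perm1.
  have := perm_closed ((sg l.+1)^-1%g (rank I l.+1 y)) sl.
  by rewrite permKV !inE => ->.
have yb : (y <= elt J l.+1 b)%N.
  rewrite -yE; case: b bS {yE} => b bn bS; apply: IH => //.
  by rewrite addSnnS.
apply: leq_trans yb _; rewrite leqNgt; apply: contraNN Un0 => lt.
(* The vanishing factor: level l, variable a, and b in the second product. *)
apply/prodf_eq0; exists (Ordinal lN); first by [].
apply/prodf_eq0; exists oa; first by [].
rewrite !mulf_eq0; apply/orP; left; apply/orP; left; apply/orP; right.
apply/prodf_eq0; exists b; first by rewrite bS.
by rewrite !lev_permute_spec // yE subrr bracket0.
Qed.

Hypothesis hgen : generic logq r u P.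

Let w (a b : 'I_n) : R[i] := br (u b - u a) / br (u b - u a + 1).

Lemma br_diff_neq0 (a b : 'I_n) : a != b -> br (u b - u a) != 0.
Proof. by case: hgen => _ H _ /H[]. Qed.

Lemma br_diff1_neq0 (a b : 'I_n) : br (u b - u a + 1) != 0.
Proof.
have [->|ab] := eqVneq a b; first by rewrite subrr add0r; case: hgen.
by case: hgen => _ /(_ _ _ ab)[].
Qed.

Lemma Hfun_spec I : is_partition lam I ->
  Hfun logq r lam u (spec I u) =
    \prod_(l < N | (0 < l)%N) \prod_(s in Iup I l)
      \prod_(x in Iup I l.+1) br (u x - u s + 1).
Proof.
move=> hI; apply: eq_bigr => l l0.
rewrite -[RHS](big_elt_all hI); apply: eq_bigr => a _.
rewrite -[RHS](big_elt_all hI); apply: eq_bigr => b _.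
rewrite !lev_spec.
reflexivity.
Qed.

(** The variables of the dynamical factor agree at z_I, so that factor is
    [0 + d][1] / [d] = [1] since [d] is nonzero. *)
Lemma Ufun_spec I : is_partition lam I ->
  Ufun logq r lam I u P (spec I u) =
    \prod_(l < N | (0 < l)%N) \prod_(s in Iup I l)
      (br 1 * (\prod_(x in Iup I l.+1 | (s < x)%N) br (u x - u s))
            * (\prod_(x in Iup I l.+1 | (x < s)%N) br (u x - u s + 1))
            * (\prod_(x in Iup I l | (s < x)%N) (w s x)^-1)).
Proof.
move=> hI; apply: eq_bigr => l l0.
rewrite -[RHS](big_elt_all hI); apply: eq_bigr => a al.
apply: (congr2 *%R); [apply: (congr2 *%R); [apply: (congr2 *%R)|]|].
- have sl := mem_elt hI al; set s := elt I l a in sl *.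
  pose d := P (I s) l - (Cshift I l s)%:~R.
  rewrite (eq_bigr (fun b => br (u (elt I l.+1 b) - u s + d) * br 1 / br d));
    last by move=> b _; rewrite !lev_spec; reflexivity.
  rewrite (big_elt hI _ _ (pred1 s) (fun x => br (u x - u s + d) * br 1 / br d)).
  rewrite (big_pred1 s) => [|x /=]; last first.
    apply: andb_idl => /eqP->; move: sl; rewrite !mem_Iup; exact: leqW.
  rewrite subrr add0r mulrAC divff ?mul1r //.
  case: hgen => _ _ H; rewrite /d -mulrNz; apply: H.
    by move: sl; rewrite mem_Iup.
  by rewrite abszN; apply: abs_Cshift_lt.
- rewrite -[RHS](big_elt hI); apply: eq_bigr => b _; rewrite !lev_spec.
  reflexivity.
- rewrite -[RHS](big_elt hI); apply: eq_bigr => b _; rewrite !lev_spec.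
  reflexivity.
- rewrite -[RHS](big_elt hI); apply: eq_big => [b|b _].
    rewrite [in RHS]andbC; have [bl|bl] := boolP (b < lamup lam l)%N.
      by rewrite !andbT (elt_ltnE hI).
    by rewrite !andbF.
  by rewrite !lev_spec /w invf_div.
Qed.

Lemma Ufun_div_Hfun_spec I : is_partition lam I ->
  Ufun logq r lam I u P (spec I u) / Hfun logq r lam u (spec I u) =
    \prod_(k < N) \prod_(l < N | (k < l)%N)
      \prod_(a in block I k) \prod_(b in block I l | (a < b)%N) w a b.
Proof.
move=> hI; rewrite Ufun_spec // Hfun_spec // -prodf_div.
under eq_bigr => l _.
  rewrite -prodf_div; under eq_bigr => s sl.
    (* [1] is the x = s instance of [u_x - u_s + 1]. *)
    rewrite -[br 1](_ : br (u s - u s + 1) = _); last by rewrite subrr add0r.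
    rewrite (prod_level_ratio sl (g := fun x => br (u x - u s))
      (h := fun x => br (u x - u s + 1))) => [|x xs|x].
    - over.
    - by apply: br_diff_neq0; rewrite eq_sym.
    - exact: br_diff1_neq0.
  over.
rewrite [RHS](exchange_big_dep (fun l : 'I_N => (0 < l)%N)) /=; last first.
  by move=> k l _; apply: leq_ltn_trans.
apply: eq_bigr => l _.
rewrite (partition_big I (fun k : 'I_N => (k < l)%N)) /=; last first.
  by move=> s; rewrite mem_Iup.
apply: eq_bigr => k kl; apply: eq_bigl => s.
by rewrite mem_Iup inE; apply: andb_idl => /eqP->.
Qed.

Lemma Wtilde_spec_eq0 I J : is_partition lam I -> is_partition lam J ->
  ~ part_le lam I J -> Wtilde logq r lam J u P (spec I u) = 0.
Proof.
move=> hI hJ nle; rewrite /Wtilde /Wfun foldr_Sym_eq0 ?mul0r ?iota_uniq //.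
move=> sg ad; apply/eqP/negPn/negP => Un0; apply: nle => l a lN al.
have dom := Ufun_neq0_dominated hI hJ ad Un0.
apply: (perm_dominated_le (m := lamup lam l) (s := sg l)
          (f := elt I l) (g := elt J l)) al.
- by have := ad l; case: ifP => // _ ->; apply: perm_on1.
- by move=> b c; apply: (elt_leq hI).
- by move=> b c; apply: (elt_leq hJ).
- by move=> b; apply: dom.
Qed.

(** For I = J the domination reads elt I l (s a) <= elt I l a, that is s a <= a,
    so no permutation other than the identity contributes. *)
Lemma Wtilde_spec_diag I : is_partition lam I ->
  Wtilde logq r lam I u P (spec I u) =
  Ufun logq r lam I u P (spec I u) / Hfun logq r lam u (spec I u).
Proof.
move=> hI; rewrite /Wtilde /Wfun foldr_Sym_id ?iota_uniq // => sg ad Un0 l lls.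
have sl := ad l; rewrite lls in sl.
apply: perm_decreasing_id => a.
have [al|al] := boolP (a < lamup lam l)%N; last first.
  by rewrite (out_perm sl) // inE.
have sal : (sg l a < lamup lam l)%N by have := perm_closed a sl; rewrite !inE al.
rewrite leqNgt -(elt_ltnE hI al sal) -leqNgt.
apply: (Ufun_neq0_dominated hI hI ad Un0) => //.
by move: lls; rewrite mem_levels => /andP[-> /ltnW].
Qed.

End WeightFunctions.

(** * Triangularity and diagonal values *)

Theorem proposition5p1 (R : realType) (q logq : R[i]) (r : R)
  (hq : 0 < `|q| < 1) (hlogq : cexp logq = q) (hr : 0 < r)
  (N n : nat) (lam : 'I_N -> nat) (hlam : (\sum_(c < N) lam c)%N = n)
  (I J : {ffun 'I_n -> 'I_N})
  (hI : is_partition lam I) (hJ : is_partition lam J)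
  (u : 'I_n -> R[i]) (P : 'I_N -> 'I_N -> R[i])
  (hP : forall j k l : 'I_N, P j k + P k l = P j l)
  (hgen : generic logq r u P) :
  (~ part_le lam I J -> Wtilde logq r lam J u P (spec I u) = 0) /\
  Wtilde logq r lam I u P (spec I u) =
    \prod_(k < N) \prod_(l < N | (k < l)%N)
      \prod_(a in block I k) \prod_(b in block I l | (a < b)%N)
        (bracket logq r (u b - u a) / bracket logq r (u b - u a + 1)).
Proof.
split; first exact: Wtilde_spec_eq0.
by rewrite Wtilde_spec_diag // Ufun_div_Hfun_spec.
Qed.
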